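(* Let $\Phi\subset\mathbb{R}^3$ be a skew ruled surface of class $C^3$, parametrized by $\boldsymbol{x}(u,v)=\boldsymbol{s}(u)+v\,\boldsymbol{e}(u)$, $(u,v)\in I\times\mathbb{R}$, as in the context, with conical curvature $k(u)$, distribution parameter $\delta(u)$, $\lambda(u)=\cot\sigma(u)$ and $w=\sqrt{v^2+\delta(u)^2}$. Suppose that the normal curvature $k_N$ along the orthogonal trajectories of the generators (i.e. of the rulings $u=\text{const}$) has the form $$k_N=f(u)\,w^{n}\qquad\text{at every point }(u,v)\in I\times\mathbb{R},$$ with some $n\in\mathbb{Z}$ and some continuous function $f:I\to\mathbb{R}$. Then one of the following holds: (a) $f=0$ and $\Phi$ is a (right) helicoid. (b) $n=-3$, $f(u)=-\delta^2(u)\,\lambda(u)$, and $\Phi$ is a conoid of constant distribution parameter. (c) $n=-1$, $f(u)=-k(u)$, and $\Phi$ is an orthoid of constant distribution parameter.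
   Context: Setting. $I\subset\mathbb{R}$ is an open interval and $\Phi$ is a regular ruled surface in Euclidean space $\mathbb{R}^3$ without torsal generators (''skew''), of class $C^3$ on $I\times\mathbb{R}$, with parametrization $\boldsymbol{x}(u,v)=\boldsymbol{s}(u)+v\,\boldsymbol{e}(u)$, where $\boldsymbol{s}$ is the striction line and $\boldsymbol{e}$ is the unit vector along the generators. Prime denotes $d/du$. It is assumed that $\langle \boldsymbol{s}'(u),\boldsymbol{e}'(u)\rangle=0$ and $|\boldsymbol{e}'(u)|=1$ for all $u\in I$. Moving frame: $\boldsymbol{n}:=\boldsymbol{e}'$, $\boldsymbol{z}:=\boldsymbol{e}\times\boldsymbol{n}$. Invariants (with $(\cdot,\cdot,\cdot)$ the triple product): conical curvature $k=(\boldsymbol{e},\boldsymbol{e}',\boldsymbol{e}'')$; distribution parameter (Drall) $\delta=(\boldsymbol{e},\boldsymbol{e}',\boldsymbol{s}')$, which is nowhere zero since $\Phi$ is skew; striction $\sigma$, the angle between $\boldsymbol{e}$ and $\boldsymbol{s}'$, and $\lambda:=\cot\sigma=\langle\boldsymbol{e},\boldsymbol{s}'\rangle/\delta$. Thus $\boldsymbol{s}'=\delta\lambda\,\boldsymbol{e}+\delta\,\boldsymbol{z}$. With $u^1=u$, $u^2=v$ and $w:=\sqrt{v^2+\delta^2}$, the fundamental forms (unit normal $(\boldsymbol{x}_u\times\boldsymbol{x}_v)/w$) are $g_{11}=v^2+\delta^2(\lambda^2+1)$, $g_{12}=\delta\lambda$, $g_{22}=1$, $h_{11}=-\frac1w\,[k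 v^2+\delta' v+\delta^2(k-\lambda)]$, $h_{12}=\frac{\delta}{w}$, $h_{22}=0$. The normal curvature in direction $du:dv$ is $k_N=\dfrac{h_{11}du^2+2h_{12}du\,dv+h_{22}dv^2}{g_{11}du^2+2g_{12}du\,dv+g_{22}dv^2}$; the normal curvature along a curve is that in its tangent direction. The orthogonal trajectories of the generators are determined by $\delta\lambda\,du+dv=0$. Terminology. $\Phi$ is an orthoid if $\lambda=0$ identically on $I$, and a conoid if $k=0$ identically on $I$ (all generators parallel to a fixed plane); it has constant distribution parameter if $\delta'=0$ identically. $\Phi$ is a (right) helicoid (Wendelfläche) if $k=\lambda=\delta'=0$ identically on $I$. ''$f=0$'' means that $f$ vanishes identically on $I$. *)

(* Defs.v *)
From mathcomp Require Import all_boot all_order all_algebra.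
From mathcomp Require Import all_classical all_reals all_analysis.
Import Order.TTheory GRing.Theory Num.Theory.
Import numFieldNormedType.Exports.

Set Implicit Arguments.
Unset Strict Implicit.
Unset Printing Implicit Defensive.

Local Open Scope classical_set_scope.
Local Open Scope ring_scope.

(* MathComp-Analysis, over an arbitrary R : realType.

   R^3 is 'rV[R]_3. The norm that the library puts on row vectors is the sup
   norm; it is used here only through the topology it induces. Lengths and
   angles always refer to the Euclidean [dot] and [enorm] below. *)

Section Euclidean3.
Context {R : realType}.
Implicit Types a b c : 'rV[R]_3.

Definition dot a b : R := \sum_(i < 3) a 0 i * b 0 i.

Definition enorm a : R := Num.sqrt (dot a a).

(* Indices are added in 'I_3, i.e. modulo 3. *)
Definition cross a b : 'rV[R]_3 :=
  \row_(i < 3) (a 0 (i + 1) * b 0 (i + 2%:R) - a 0 (i + 2%:R) * b 0 (i + 1)).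

Definition triple a b c : R := dot (cross a b) c.

End Euclidean3.

Section ParametrizedSurface.
Context {R : realType}.
Implicit Types (x : R * R -> 'rV[R]_3) (p d : R * R).

Definition pu x : R * R -> 'rV[R]_3 := 'D_(1, 0) x.
Definition pv x : R * R -> 'rV[R]_3 := 'D_(0, 1) x.

(* All partial derivatives of order at most r (in any order of differentiation)
   exist and are continuous on D; meant for D open. *)
Fixpoint class_C (r : nat) (D : set (R * R)) x : Prop :=
  {within D, continuous x} /\
  if r is r'.+1 then
    [/\ forall p, D p -> derivable x p (1, 0) /\ derivable x p (0, 1),
        class_C r' D (pu x) & class_C r' D (pv x)]
  else True.

Definition unit_normal x p : 'rV[R]_3 :=
  (enorm (cross (pu x p) (pv x p)))^-1 *: cross (pu x p) (pv x p).

Definition g11 x p : R := dot (pu x p) (pu x p).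
Definition g12 x p : R := dot (pu x p) (pv x p).
Definition g22 x p : R := dot (pv x p) (pv x p).

Definition h11 x p : R := dot (pu (pu x) p) (unit_normal x p).
Definition h12 x p : R := dot (pv (pu x) p) (unit_normal x p).
Definition h22 x p : R := dot (pv (pv x) p) (unit_normal x p).

(* The direction du : dv is the pair d = (du, dv), considered when nonzero. *)
Definition normal_curvature x p d : R :=
  (h11 x p * d.1 ^+ 2 + 2 * h12 x p * d.1 * d.2 + h22 x p * d.2 ^+ 2) /
  (g11 x p * d.1 ^+ 2 + 2 * g12 x p * d.1 * d.2 + g22 x p * d.2 ^+ 2).

End ParametrizedSurface.

Section RuledSurface.
Context {R : realType}.
Implicit Types (s e : R -> 'rV[R]_3) (I : set R).

(* Only the values of s and e on I matter below: I is open, so the derivatives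
   at points of I are determined by them. *)
Definition ruled s e : R * R -> 'rV[R]_3 := fun p => s p.1 + p.2 *: e p.1.

Definition conical_curvature e (u : R) : R := triple (e u) (derive1 e u) (derive1n 2 e u).

Definition drall s e (u : R) : R := triple (e u) (derive1 e u) (derive1 s u).

(* lambda = cot sigma, sigma being the striction, i.e. the angle between
   e and s' = |s'| (cos sigma e + sin sigma z), with z = e x e'. *)
Definition cot_striction s e (u : R) : R := dot (e u) (derive1 s u) / drall s e u.

(* Here skew means that no generator is torsal, i.e. (e, e', s') <> 0. *)
Record skew_ruled_surface I s e : Prop := SkewRuledSurface {
  srs_class : class_C 3 (I `*` [set: R]) (ruled s e) ;
  srs_regular : forall p, (I `*` [set: R]) p ->
    cross (pu (ruled s e) p) (pv (ruled s e) p) != 0 ;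
  srs_unit : forall u, I u -> enorm (e u) = 1 ;
  srs_striction : forall u, I u -> dot (derive1 s u) (derive1 e u) = 0 ;
  srs_arclength : forall u, I u -> enorm (derive1 e u) = 1 ;
  srs_skew : forall u, I u -> drall s e u != 0
}.

Definition orthoid I s e : Prop := forall u, I u -> cot_striction s e u = 0.

Definition conoid I e : Prop := forall u, I u -> conical_curvature e u = 0.

Definition constant_drall I s e : Prop := forall u, I u -> derive1 (drall s e) u = 0.

Definition helicoid I s e : Prop :=
  [/\ conoid I e, orthoid I s e & constant_drall I s e].

(* The tangent vector x_u du + x_v dv is orthogonal to the generator, whose
   tangent vector is x_v: g12 du + g22 dv = 0, which is
   delta lambda du + dv = 0 for a skew ruled surface. *)
Definition orthogonal_direction s e (p d : R * R) : Prop :=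
  d != 0 /\ g12 (ruled s e) p * d.1 + g22 (ruled s e) p * d.2 = 0.

End RuledSurface.

(* Main.v *)
Require Import Defs.
From mathcomp Require Import all_boot all_order all_algebra.
From mathcomp Require Import all_classical all_reals all_analysis.
From mathcomp Require Import ring lra.
Import Order.TTheory GRing.Theory Num.Theory.
Import numFieldNormedType.Exports.

Set Implicit Arguments.
Unset Strict Implicit.
Unset Printing Implicit Defensive.

Local Open Scope classical_set_scope.
Local Open Scope ring_scope.

(** The proof is pointwise in [u]. Write [z = e x e']. At the point
[(u, v)] the direction orthogonal to the ruling is [1 : - <e, s'>], that is
[1 : - delta lambda], and along it
[[
   k_N = - (k v^2 + delta' v + delta^2 (k + lambda)) / w^3
]]
([orthogonal_normal_curvature]). This formula comes from expanding all vectors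
in the orthonormal frame [e, e', z]. The coordinates needed are obtained by
differentiating the constant functions [<e, e>], [<e', e'>], [<e, e'>] and
[<s', e'>], and by differentiating [delta = (e, e', s')] as a triple product.

If [k_N = f w^n], then for a fixed [u] the quadratic polynomial
[k v^2 + delta' v + delta^2 (k + lambda)] in [v] equals [- f w^(n+3)]. The
latter is even in [v], so [delta' = 0], and what remains is
[k w^2 + delta^2 lambda = - f w^(n+3)] for all [w >= |delta|]. A combination of
a constant and a square is a multiple of a single power only if everything
vanishes, or [n + 3 = 0] with [k = 0], or [n + 3 = 2] with [lambda = 0]
([quadratic_power_law]). The exponent [n] is the same for all [u], so its value
selects the same case for every [u]: at a parameter where everything vanishes
the equations of each of the three conclusions hold. *)

(** * Euclidean identities in dimension three *)

Section VectorIdentities.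
Context {R : realType}.
Implicit Types a b c e n : 'rV[R]_3.

Lemma dotE a b :
  dot a b = a 0 0 * b 0 0 + a 0 1 * b 0 1 + a 0 2%:R * b 0 2%:R.
Proof.
rewrite /dot !big_ord_recl big_ord0 addr0 addrA.
by congr (_ + a 0 _ * b 0 _ + a 0 _ * b 0 _); apply: val_inj.
Qed.

Lemma crossE a b :
  [/\ cross a b 0 0 = a 0 1 * b 0 2%:R - a 0 2%:R * b 0 1,
      cross a b 0 1 = a 0 2%:R * b 0 0 - a 0 0 * b 0 2%:R
    & cross a b 0 2%:R = a 0 0 * b 0 1 - a 0 1 * b 0 0].
Proof.
by split; rewrite mxE;
  congr (a 0 _ * b 0 _ - a 0 _ * b 0 _); apply: val_inj.
Qed.

Lemma tripleE a b c :
  triple a b c = (a 0 1 * b 0 2%:R - a 0 2%:R * b 0 1) * c 0 0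
               + (a 0 2%:R * b 0 0 - a 0 0 * b 0 2%:R) * c 0 1
               + (a 0 0 * b 0 1 - a 0 1 * b 0 0) * c 0 2%:R.
Proof. by rewrite /triple dotE; have [-> -> ->] := crossE a b. Qed.

Lemma dotC a b : dot a b = dot b a.
Proof. by rewrite !dotE; ring. Qed.

Lemma dotDl a b c : dot (a + b) c = dot a c + dot b c.
Proof. by rewrite !dotE !mxE; ring. Qed.

Lemma dotZl (t : R) a b : dot (t *: a) b = t * dot a b.
Proof. by rewrite !dotE !mxE; ring. Qed.

Lemma dotZr (t : R) a b : dot a (t *: b) = t * dot a b.
Proof. by rewrite dotC dotZl dotC. Qed.

Lemma dotDr a b c : dot a (b + c) = dot a b + dot a c.
Proof. by rewrite dotC dotDl !(dotC a). Qed.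

Lemma dot0l a : dot 0 a = 0.
Proof. by rewrite !dotE !mxE; ring. Qed.

Lemma tripleDr a b c d : triple a b (c + d) = triple a b c + triple a b d.
Proof. exact: dotDr. Qed.

Lemma tripleZr (t : R) a b c : triple a b (t *: c) = t * triple a b c.
Proof. exact: dotZr. Qed.

Lemma triplerr a b : triple a b b = 0.
Proof. by rewrite tripleE; ring. Qed.

Lemma dot_cross_swap a b c : dot b (cross a c) = - triple c a b.
Proof.
by rewrite dotE tripleE; have [-> -> ->] := crossE a c; ring.
Qed.

Lemma dot_crossxx a b :
  dot (cross a b) (cross a b) = dot a a * dot b b - dot a b ^+ 2.
Proof.
by rewrite !dotE; have [-> -> ->] := crossE a b; ring.
Qed.

Lemma enorm_sqr a : enorm a ^+ 2 = dot a a.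
Proof.
rewrite sqr_sqrtr// dotE -!expr2.
by rewrite !addr_ge0 ?sqr_ge0.
Qed.

Lemma enorm1_dot a : enorm a = 1 -> dot a a = 1.
Proof. by rewrite -enorm_sqr => ->; rewrite expr1n. Qed.

Section Orthonormal.
Variables e n : 'rV[R]_3.
Hypotheses (ee : dot e e = 1) (nn : dot n n = 1) (en : dot e n = 0).

(** The triple product with [e] is the determinant of the components orthogonal
to [e]. Throughout, the third vector of the frame is [cross e n], and the
coordinate of [a] along it is [triple e n a]. *)
Lemma orthonormal_triple a b :
  triple e a b = dot n a * triple e n b - triple e n a * dot n b.
Proof.
(* Both sides now compute the product of cross a b with cross n (cross e n),
   for arbitrary e and n. *)
transitivity (dot n n * triple e a b - dot e n * triple n a b).
  by rewrite nn en; ring.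
by rewrite !tripleE !dotE; ring.
Qed.

(** Parseval's identity for the frame. *)
Lemma orthonormal_dot a b :
  dot a b = dot e a * dot e b + dot n a * dot n b + triple e n a * triple e n b.
Proof.
(* The added terms vanish on an orthonormal pair; with them the equality is a
   polynomial identity in the coordinates, valid for all e and n. *)
transitivity (dot a b * (dot e e * dot n n - dot e n ^+ 2)
  + dot e a * dot e b * (1 - dot n n) + dot n a * dot n b * (1 - dot e e)
  + dot e n * (dot e a * dot n b + dot n a * dot e b)).
  by rewrite ee nn en; ring.
by rewrite !tripleE !dotE; ring.
Qed.

(** The vectors [ds], [dn], [dds] stand for the values of [s'], [n'], [s''] at
one parameter: the computations below involve only the algebraic relations
between these values. *)
Section MovingFrame.
Variables ds dn dds : 'rV[R]_3.
Hypotheses (n_dn : dot n dn = 0) (n_ds : dot n ds = 0).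

(** The second premise is the derivative of the striction condition
[<s', n> = 0]; it determines [<n, s''>] because [n'] is [- e + k z]. *)
Lemma frame_dot_dds :
  dot e dn = - 1 -> dot dds n + dot ds dn = 0 ->
  dot n dds = dot e ds - triple e n ds * triple e n dn.
Proof.
by move=> e_dn; rewrite (orthonormal_dot ds dn) n_dn e_dn (dotC dds); lra.
Qed.

(** The left-hand side is the derivative of [(e, n, s')] by the product rule.
The middle term vanishes as well: by [n_ds] and [n_dn], the vectors [s'] and
[n'] both lie in the plane of [e] and [z]. *)
Lemma frame_derive_triple :
  triple n n ds + triple e dn ds + triple e n dds = triple e n dds.
Proof.
by rewrite (orthonormal_triple dn ds) n_dn n_ds [triple n n ds]tripleE; ring.
Qed.

Variable v : R.
Let w := Num.sqrt (v ^+ 2 + triple e n ds ^+ 2).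
Let N := cross (ds + v *: n) e.

Lemma ruled_tangent_coord :
  [/\ dot e (ds + v *: n) = dot e ds, dot n (ds + v *: n) = v
    & triple e n (ds + v *: n) = triple e n ds].
Proof.
rewrite !dotDr !dotZr tripleDr tripleZr triplerr nn en n_ds.
by split; ring.
Qed.

Lemma ruled_normal_norm : enorm N = w.
Proof.
have [e_xu n_xu z_xu] := ruled_tangent_coord.
rewrite /enorm dot_crossxx (orthonormal_dot (ds + v *: n)) ee (dotC _ e).
by rewrite e_xu n_xu z_xu /w; congr Num.sqrt; ring.
Qed.

Lemma ruled_normal_dot a :
  dot a ((enorm N)^-1 *: N) = (triple e n ds * dot n a - v * triple e n a) / w.
Proof.
have [_ n_xu z_xu] := ruled_tangent_coord.
rewrite ruled_normal_norm dotZr dot_cross_swap orthonormal_triple n_xu z_xu.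
by rewrite mulrC; congr (_ / _); ring.
Qed.

Lemma ruled_tangent_dot :
  [/\ dot (ds + v *: n) (ds + v *: n) = w ^+ 2 + dot e ds ^+ 2,
      dot (ds + v *: n) e = dot e ds & dot e e = 1].
Proof.
have [e_xu _ _] := ruled_tangent_coord; rewrite (dotC _ e).
split=> //; rewrite -ruled_normal_norm enorm_sqr dot_crossxx (dotC _ e) e_xu ee.
by ring.
Qed.

(** The left-hand side is the quotient of the two fundamental forms at
[(u, v)] in the direction [1 : - L], with their coefficients written out. Its
denominator collapses to [w ^+ 2], because the direction is orthogonal to the
ruling. *)
Lemma ruled_orthogonal_curvature (k := triple e n dn) (L := dot e ds)
    (N1 := (enorm N)^-1 *: N) :
  triple e n ds != 0 -> dot n dds = L - triple e n ds * k ->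
  (dot (dds + v *: dn) N1 * 1 ^+ 2 + 2 * dot n N1 * 1 * (- L)
    + dot 0 N1 * (- L) ^+ 2) /
  (dot (ds + v *: n) (ds + v *: n) * 1 ^+ 2
    + 2 * dot (ds + v *: n) e * 1 * (- L) + dot e e * (- L) ^+ 2) =
  - (k * v ^+ 2 + triple e n dds * v
      + (triple e n ds ^+ 2 * k + triple e n ds * L)) / w ^+ 3.
Proof.
move=> skew n_dds.
have w0 : w != 0.
  by rewrite gt_eqF// sqrtr_gt0 ltr_wpDl ?sqr_ge0// exprn_even_gt0.
have [-> -> ->] := ruled_tangent_dot.
rewrite dot0l !ruled_normal_dot dotDr dotZr tripleDr tripleZr nn n_dn n_dds.
rewrite triplerr -/k -/L.
clearbody w; field; rewrite w0 /=.
by rewrite (_ : _ + _ = w ^+ 2) ?expf_neq0//; ring.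
Qed.

End MovingFrame.

End Orthonormal.

End VectorIdentities.

(** * Product rules *)

Section Derivatives.
Context {R : realType} {V : normedModType R}.
Implicit Types a b c : V -> 'rV[R]_3.

Lemma is_derive_derive1 (W : normedModType R) (a : R -> W) u :
  derivable a u 1 -> is_derive u 1 a (derive1 a u).
Proof. by move=> a_drv; apply: DeriveDef; [exact: a_drv|rewrite derive1E]. Qed.

Lemma is_derive_coord a t v (da : 'rV[R]_3) (i : 'I_3) :
  is_derive t v a da -> is_derive t v (fun x => a x 0 i) (da 0 i).
Proof.
case=> a_drv <-; apply: DeriveDef; first by move/derivable_mxP: a_drv.
by rewrite derive_mx// mxE.
Qed.

Lemma is_derive_rV a t v (da : 'rV[R]_3) :
  (forall i : 'I_3, is_derive t v (fun x => a x 0 i) (da 0 i)) ->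
  is_derive t v a da.
Proof.
move=> a_i; have a_drv : derivable a t v.
  by apply/derivable_mxP => i j; rewrite ord1; exact: ex_derive.
apply: DeriveDef => //; rewrite derive_mx//.
by apply/rowP => j; rewrite mxE derive_val.
Qed.

Lemma is_derive_dot a b t v (da db : 'rV[R]_3) :
  is_derive t v a da -> is_derive t v b db ->
  is_derive t v (fun x => dot (a x) (b x)) (dot da (b t) + dot (a t) db).
Proof.
move=> a_drv b_drv.
have -> : (fun x => dot (a x) (b x)) =
    \sum_(i < 3) ((fun x => a x 0 i) * (fun x => b x 0 i)).
  by apply/funext => x; rewrite fct_sumE.
have a_i i := is_derive_coord i a_drv; have b_i i := is_derive_coord i b_drv.
apply: is_derive_eq; rewrite /dot -big_split /=; apply: eq_bigr => i _.
by rewrite addrC; congr (_ + _); rewrite mulrC.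
Qed.

Lemma is_derive_cross a b t v (da db : 'rV[R]_3) :
  is_derive t v a da -> is_derive t v b db ->
  is_derive t v (fun x => cross (a x) (b x)) (cross da (b t) + cross (a t) db).
Proof.
move=> a_drv b_drv.
have a_i i := is_derive_coord i a_drv; have b_i i := is_derive_coord i b_drv.
apply: is_derive_rV => i.
have -> : (fun x => cross (a x) (b x) 0 i) =
    (fun x => a x 0 (i + 1)) * (fun x => b x 0 (i + 2%:R))
  - (fun x => a x 0 (i + 2%:R)) * (fun x => b x 0 (i + 1)).
  by apply/funext => x; rewrite mxE.
by apply: is_derive_eq; rewrite !mxE /GRing.scale /=; ring.
Qed.

Lemma is_derive_triple a b c t v (da db dc : 'rV[R]_3) :
  is_derive t v a da -> is_derive t v b db -> is_derive t v c dc ->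
  is_derive t v (fun x => triple (a x) (b x) (c x))
    (triple da (b t) (c t) + triple (a t) db (c t) + triple (a t) (b t) dc).
Proof.
move=> a_drv b_drv c_drv.
apply: is_derive_eq (is_derive_dot (is_derive_cross a_drv b_drv) c_drv) _.
by rewrite dotDl.
Qed.

(** Source of all the relations between the frame and its derivatives. *)
Lemma is_derive_constant_dot (A : set V) a b (c : R) t v (da db : 'rV[R]_3) :
  open A -> A t -> (forall y, A y -> dot (a y) (b y) = c) ->
  is_derive t v a da -> is_derive t v b db -> dot da (b t) + dot (a t) db = 0.
Proof.
move=> A_open At ab_c a_drv b_drv; have ab_drv := is_derive_dot a_drv b_drv.
rewrite -(@derive_val _ _ _ _ _ _ _ ab_drv) -(derive_cst c t v).
apply: near_eq_derive; have : \forall y \near t, A y by exact: open_nbhs_nbhs.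
by apply: filterS => y /ab_c.
Qed.

End Derivatives.

(** * Partial derivatives of a ruled parametrization *)

Section Ruled.
Context {R : realType}.
Implicit Types (x : R * R -> 'rV[R]_3) (a b : R -> 'rV[R]_3).

Lemma pu_slice x u v :
  derivable x (u, v) (1, 0) = derivable (fun t => x (t, v)) u 1
  /\ pu x (u, v) = derive1 (fun t => x (t, v)) u.
Proof.
rewrite derive1E /pu /derivable /derive.
set F := (fun h : R => _); set G := (fun h : R => _).
suff -> : F = G by [].
apply/funext => h; rewrite /F /G /=.
by congr (_ *: (x (_, _) - _)); rewrite /= ?scaler0 ?add0r.
Qed.

Lemma pv_slice x u v : pv x (u, v) = derive1 (fun t => x (u, t)) v.
Proof.
rewrite derive1E /pv /derive.
set F := (fun h : R => _); set G := (fun h : R => _).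
suff -> : F = G by [].
apply/funext => h; rewrite /F /G /=.
by congr (_ *: (x (_, _) - _)); rewrite /= ?scaler0 ?add0r.
Qed.

(** The map [x] is only assumed to agree with [ruled a b] above [I]. With this
generality the lemmas apply to [ruled s e] and again to its partial derivative
[pu (ruled s e)], which is [ruled s' e'] above [I] only. *)
Variables (I : set R) (x : R * R -> 'rV[R]_3) (a b : R -> 'rV[R]_3).
Hypotheses (I_open : open I)
  (x_ruled : forall t v, I t -> x (t, v) = ruled a b (t, v))
  (x_derivable : forall p, (I `*` [set: R]) p -> derivable x p (1, 0)).

Lemma near_slice u v : I u -> \forall t \near u, x (t, v) = a t + v *: b t.
Proof.
move=> Iu; have : \forall t \near u, I t by exact: open_nbhs_nbhs.
by apply: filterS => t It; rewrite x_ruled.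
Qed.

(** The curves are recovered from the slices [v = 0] and [v = 1]. *)
Lemma ruled_derivable u : I u -> derivable a u 1 /\ derivable b u 1.
Proof.
move=> Iu.
have slice v : derivable (fun t => a t + v *: b t) u 1.
  apply: near_eq_derivable (near_slice v Iu) _.
  by have [<- _] := pu_slice x u v; exact: x_derivable.
have a_drv : derivable a u 1.
  have -> : a = (fun t => a t + 0 *: b t).
    by apply/funext => t; rewrite scale0r addr0.
  exact: slice.
split; first exact: a_drv.
have -> : b = (fun t => a t + 1 *: b t) - a.
  apply/funext => t; transitivity (a t + 1 *: b t - a t) => //.
  by rewrite scale1r addrC addKr.
exact: (derivableB (slice 1) a_drv).
Qed.

Lemma pu_ruled u v : I u -> pu x (u, v) = ruled (derive1 a) (derive1 b) (u, v).
Proof.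
move=> Iu; have [a_drv b_drv] := ruled_derivable Iu.
have [_ ->] := pu_slice x u v.
rewrite derive1E (near_eq_derive _ (near_slice v Iu)) /ruled /= !derive1E.
have -> : (fun t => a t + v *: b t) = a + v \*: b by [].
by rewrite (deriveD a_drv (derivableZ b_drv)) (deriveZ _ b_drv).
Qed.

Lemma pv_ruled u v : I u -> pv x (u, v) = b u.
Proof.
move=> Iu; rewrite pv_slice.
have -> : (fun t => x (u, t)) = (fun t => a u + t *: b u).
  by apply/funext => t; rewrite x_ruled.
rewrite derive1E; apply: derive_val; apply: is_derive_rV => i.
have -> : (fun t => (a u + t *: b u) 0 i) = cst (a u 0 i) + id * cst (b u 0 i).
  by apply/funext => t; rewrite !mxE.
apply: is_derive_eq (is_deriveD (is_derive_cst _ _ _)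
  (is_deriveM (is_derive_id _ _) (is_derive_cst _ _ _))) _.
by rewrite /GRing.scale /= add0r mulr0 add0r mulr1.
Qed.
End Ruled.

(** * The normal curvature across the rulings *)

Lemma normal_curvatureE {R : realType} (x : R * R -> 'rV[R]_3) p d
    (xu xv xuu xuv xvv : 'rV[R]_3) :
  pu x p = xu -> pv x p = xv ->
  pu (pu x) p = xuu -> pv (pu x) p = xuv -> pv (pv x) p = xvv ->
  let N := (enorm (cross xu xv))^-1 *: cross xu xv in
  [/\ g12 x p = dot xu xv, g22 x p = dot xv xv &
   normal_curvature x p d =
    (dot xuu N * d.1 ^+ 2 + 2 * dot xuv N * d.1 * d.2 + dot xvv N * d.2 ^+ 2) /
    (dot xu xu * d.1 ^+ 2 + 2 * dot xu xv * d.1 * d.2 + dot xv xv * d.2 ^+ 2)].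
Proof. by move=> <- <- <- <- <-. Qed.

Section SkewRuledSurface.
Context {R : realType}.
Variables (I : set R) (s e : R -> 'rV[R]_3).
Hypotheses (I_open : open I) (Phi : skew_ruled_surface I s e).

Local Notation x := (ruled s e).
Local Notation n := (derive1 e).
Local Notation ds := (derive1 s).
Local Notation dn := (derive1n 2 e).
Local Notation dds := (derive1n 2 s).

Let x_derivable p : (I `*` [set: R]) p -> derivable x p (1, 0).
Proof.
move=> Dp; have [_ [partials _ _]] := srs_class Phi.
exact: (proj1 (partials p Dp)).
Qed.

Let pu_x t v : I t -> pu x (t, v) = ruled ds n (t, v).
Proof. exact: (pu_ruled I_open _ x_derivable). Qed.

Let pu_x_derivable p : (I `*` [set: R]) p -> derivable (pu x) p (1, 0).
Proof.
move=> Dp; have [_ [_ [_ [partials _ _]] _]] := srs_class Phi.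
exact: (proj1 (partials p Dp)).
Qed.

Lemma skew_ruled_is_derive u : I u ->
  [/\ is_derive u 1 e (n u), is_derive u 1 ds (dds u) & is_derive u 1 n (dn u)].
Proof.
move=> Iu.
have [_ de_ex] := ruled_derivable I_open (fun _ _ _ => erefl) x_derivable Iu.
have [dds_ex dn_ex] := ruled_derivable I_open pu_x pu_x_derivable Iu.
by split; exact: is_derive_derive1.
Qed.

Lemma frame_orthonormal u : I u ->
  [/\ dot (e u) (e u) = 1, dot (n u) (n u) = 1 & dot (e u) (n u) = 0].
Proof.
move=> Iu; have [e_drv _ _] := skew_ruled_is_derive Iu.
have ee t : I t -> dot (e t) (e t) = 1.
  by move=> It; apply: enorm1_dot; exact: srs_unit Phi _ It.
split; first exact: ee.
  by apply: enorm1_dot; exact: srs_arclength Phi _ Iu.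
have := is_derive_constant_dot I_open Iu ee e_drv e_drv.
by rewrite (dotC (n u)) -mulr2n => /eqP; rewrite mulrn_eq0 => /eqP.
Qed.

Section AtParameter.
Variables (u : R) (Iu : I u).
Local Notation delta := (drall s e u).
Local Notation lambda := (cot_striction s e u).
Local Notation k := (conical_curvature e u).

(** Here skewness enters: [cot_striction] is a quotient by [drall]. *)
Lemma dot_e_ds : dot (e u) (ds u) = delta * lambda.
Proof. by rewrite mulrC divfK//; exact: srs_skew Phi _ Iu. Qed.

Lemma dot_n_dn : dot (n u) (dn u) = 0.
Proof.
have [_ _ n_drv] := skew_ruled_is_derive Iu.
have nn t : I t -> dot (n t) (n t) = 1.
  by move=> It; apply: enorm1_dot; exact: srs_arclength Phi _ It.
have := is_derive_constant_dot I_open Iu nn n_drv n_drv.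
by rewrite (dotC (dn u)) -mulr2n => /eqP; rewrite mulrn_eq0 => /eqP.
Qed.

Lemma dot_n_dds : dot (n u) (dds u) = delta * lambda - delta * k.
Proof.
have [ee nn en] := frame_orthonormal Iu.
have [e_drv ds_drv n_drv] := skew_ruled_is_derive Iu.
have e_dn : dot (e u) (dn u) = - 1.
  have en_cst t (It : I t) : dot (e t) (n t) = 0 by case: (frame_orthonormal It).
  have := is_derive_constant_dot I_open Iu en_cst e_drv n_drv.
  by rewrite nn => /eqP; rewrite addrC addr_eq0 => /eqP.
rewrite -dot_e_ds; apply: (frame_dot_dds ee nn en dot_n_dn e_dn).
exact: is_derive_constant_dot I_open Iu (srs_striction Phi) ds_drv n_drv.
Qed.

Lemma derive_drall : derive1 (drall s e) u = triple (e u) (n u) (dds u).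
Proof.
have [ee nn en] := frame_orthonormal Iu.
have [e_drv ds_drv n_drv] := skew_ruled_is_derive Iu.
have d_drv := is_derive_triple e_drv n_drv ds_drv.
rewrite derive1E; transitivity (triple (n u) (n u) (ds u)
    + triple (e u) (dn u) (ds u) + triple (e u) (n u) (dds u)).
  exact: (@derive_val _ _ _ _ _ _ _ d_drv).
apply: (frame_derive_triple nn en (dds u) dot_n_dn).
by rewrite dotC; exact: srs_striction Phi _ Iu.
Qed.

Lemma orthogonal_normal_curvature v (w := Num.sqrt (v ^+ 2 + delta ^+ 2)) :
  exists d, orthogonal_direction s e (u, v) d /\
  normal_curvature x (u, v) d =
    - (k * v ^+ 2 + derive1 (drall s e) u * v + delta ^+ 2 * (k + lambda))
      / w ^+ 3.
Proof.
have [ee nn en] := frame_orthonormal Iu.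
have xu : pu x (u, v) = ds u + v *: n u by rewrite pu_x.
have xv t : pv x (u, t) = e u by exact: (pv_ruled (I := I)).
have xuu : pu (pu x) (u, v) = dds u + v *: dn u.
  exact: (pu_ruled I_open pu_x pu_x_derivable).
have xuv : pv (pu x) (u, v) = n u by exact: (pv_ruled pu_x).
have xvv : pv (pv x) (u, v) = 0.
  rewrite pv_slice.
  have -> : (fun t => pv x (u, t)) = cst (e u) by apply/funext => t; exact: xv.
  exact: derive1_cst.
have n_ds : dot (n u) (ds u) = 0 by rewrite dotC; exact: srs_striction Phi _ Iu.
have [_ a12 a22] := ruled_tangent_dot ee nn en n_ds v.
have [x12 x22 curvature] :=
  normal_curvatureE (1, - dot (e u) (ds u)) xu (xv v) xuu xuv xvv.
exists (1, - dot (e u) (ds u)); split.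
  split; first by apply/eqP => -[/eqP]; rewrite oner_eq0.
  by rewrite x12 x22 a12 a22 /= mulr1 mul1r subrr.
have e_ds := dot_e_ds.
have n_dds : dot (n u) (dds u) = dot (e u) (ds u) - delta * k.
  by rewrite e_ds dot_n_dds.
apply: (etrans curvature).
apply: (etrans (ruled_orthogonal_curvature
  ee nn en dot_n_dn n_ds v (srs_skew Phi Iu) n_dds)).
congr (- (_ + _ * v + _) / _); first exact: esym derive_drall.
rewrite mulrDr; congr (_ + _).
transitivity (delta * (delta * lambda)); first by congr (_ * _); exact: e_ds.
by rewrite mulrA -expr2.
Qed.

End AtParameter.
End SkewRuledSurface.

(** * Quadratic polynomials equal to a power of w *)

(** With [v = delta sqrt (t^2 - 1)] the square root becomes [|delta| t],
and the hypothesis reads [A t^2 + B = C t^m] for [t >= 1]. Evaluating at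
[t = 1, 2, 4] and writing [q = 2^m] gives [3 A = C (q - 1)] and
[12 A = q C (q - 1)], hence [A (q - 4) = 0]. So either [q = 4], that is
[m = 2], or [A = 0], and then [C = 0] or [q = 1], that is [m = 0]. *)
Lemma quadratic_power_law {R : realType} (k k1 delta lambda c : R) (m : int) :
  delta != 0 ->
  (forall v, k * v ^+ 2 + k1 * v + delta ^+ 2 * (k + lambda) =
    c * Num.sqrt (v ^+ 2 + delta ^+ 2) ^ m) ->
  k1 = 0 /\ [\/ [/\ c = 0, k = 0 & lambda = 0],
              [/\ m = 0, k = 0 & c = delta ^+ 2 * lambda]
            | [/\ m = 2, lambda = 0 & c = k]].
Proof.
move=> delta0 power.
have k10 : k1 = 0.
  have := power 1; have := power (- 1); rewrite sqrrN; lra.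
split=> //.
have d_gt0 : 0 < `|delta| by rewrite normr_gt0.
pose A := k * delta ^+ 2; pose B := delta ^+ 2 * lambda.
pose C := c * `|delta| ^ m; pose q : R := 2 ^ m.
have scaled (t : R) : 1 <= t -> A * t ^+ 2 + B = C * t ^ m.
  move=> t1; have := power (delta * Num.sqrt (t ^+ 2 - 1)).
  have t21 : 0 <= t ^+ 2 - 1 by nra.
  rewrite k10 exprMn sqr_sqrtr//.
  have -> : delta ^+ 2 * (t ^+ 2 - 1) + delta ^+ 2 = (delta * t) ^+ 2 by ring.
  rewrite sqrtr_sqr normrM (ger0_norm (_ : 0 <= t)); last lra.
  by rewrite exprzMl ?unitfE ?gt_eqF//; [rewrite /A /B /C; lra|lra].
have eq1 : A + B = C by have := scaled 1 (lexx 1); rewrite exp1rz; lra.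
have eq2 : 4 * A + B = C * q.
  by have := scaled 2 ltac:(lra); rewrite -/q; lra.
have eq4 : 16 * A + B = C * (q * q).
  have := scaled (2 * 2) ltac:(lra).
  by rewrite exprzMl ?unitfE ?pnatr_eq0// -/q; lra.
have d2 : delta ^+ 2 != 0 by rewrite expf_neq0.
have lambdaB : B = 0 -> lambda = 0.
  by move/eqP; rewrite mulf_eq0 (negPf d2) => /eqP.
have kA : A = 0 -> k = 0.
  by move/eqP; rewrite mulf_eq0 (negPf d2) orbF => /eqP.
have qI : injective (fun i : int => (2 : R) ^ i).
  by apply: ieexprIz; lra.
have : A * (q - 4) = 0 by nra.
move/eqP; rewrite mulf_eq0 => /orP[/eqP A0|]; last first.
  rewrite subr_eq0 => /eqP q4.
  have m2 : m = 2 by apply: qI; rewrite -/q q4; ring.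
  have B0 : B = 0 by move: eq2; rewrite q4; lra.
  apply: Or33; split=> //; first exact: lambdaB.
  have : (c - k) * delta ^+ 2 = 0.
    move: eq1; rewrite B0 /A /C m2 -exprnP real_normK ?num_real//; lra.
  by move/eqP; rewrite mulf_eq0 (negPf d2) orbF subr_eq0 => /eqP.
have : C * (q - 1) = 0 by nra.
move/eqP; rewrite mulf_eq0 => /orP[/eqP C0|].
  apply: Or31; split; [|exact: kA|by apply: lambdaB; lra].
  have dm0 : `|delta| ^ m != 0 by rewrite expfz_neq0// gt_eqF.
  by move/eqP: C0; rewrite mulf_eq0 (negPf dm0) orbF => /eqP.
rewrite subr_eq0 => /eqP q1.
have m0 : m = 0 by apply: qI; rewrite -/q q1 expr0z.
apply: Or32; split=> //; first exact: kA.
by move: eq1; rewrite A0 /B /C m0 expr0z; lra.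
Qed.

Theorem proposition5 (R : realType) (I : set R)
  (I_interval : is_interval I) (I_open : open I) (I_nonempty : I !=set0)
  (s e : R -> 'rV[R]_3) (Phi : skew_ruled_surface I s e)
  (n : int) (f : R -> R) (f_cont : {within I, continuous f})
  (kN_form : forall u v : R, I u ->
     forall d : R * R, orthogonal_direction s e (u, v) d ->
       normal_curvature (ruled s e) (u, v) d =
         f u * Num.sqrt (v ^+ 2 + drall s e u ^+ 2) ^ n) :
  [\/ (forall u, I u -> f u = 0) /\ helicoid I s e,
      [/\ n = - 3%:Z,
          forall u, I u -> f u = - (drall s e u ^+ 2 * cot_striction s e u),
          conoid I e & constant_drall I s e]
    | [/\ n = - 1%:Z,
          forall u, I u -> f u = - conical_curvature e u,
          orthoid I s e & constant_drall I s e]].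
Proof.
have skew u (Iu : I u) : drall s e u != 0 := srs_skew Phi Iu.
have power u (Iu : I u) v : conical_curvature e u * v ^+ 2
      + derive1 (drall s e) u * v
      + drall s e u ^+ 2 * (conical_curvature e u + cot_striction s e u)
    = - f u * Num.sqrt (v ^+ 2 + drall s e u ^+ 2) ^ (n + 3).
  have [d [/(kN_form _ _ Iu) -> ]] := orthogonal_normal_curvature I_open Phi Iu v.
  set w := Num.sqrt _; have w0 : w != 0.
    by rewrite gt_eqF// sqrtr_gt0 ltr_wpDl ?sqr_ge0// exprn_even_gt0//= skew.
  move=> kN; rewrite expfzDr// [RHS]mulrA [- f u * _]mulNr kN.
  have -> : w ^ (3 : int) = w ^+ 3 by [].
  by rewrite !mulNr opprK divfK// expf_neq0.
have pointwise u (Iu : I u) := quadratic_power_law (skew u Iu) (power u Iu).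
have drall_cst : constant_drall I s e by move=> u /pointwise[].
have [n3|n3] := eqVneq n (- 3%:Z).
  apply: Or32; split=> // u Iu; have [_ H] := pointwise u Iu.
    case: H => [[f0 _ l0]|[_ _]|[/eqP]]; last by rewrite n3.
      by move/eqP: f0; rewrite oppr_eq0 l0 mulr0 oppr0 => /eqP.
    by move=> <-; rewrite opprK.
  by case: H => [[]|[]|[/eqP]] //; rewrite n3.
have [n1|n1] := eqVneq n (- 1%:Z).
  apply: Or33; split=> // u Iu; have [_ H] := pointwise u Iu.
    case: H => [[f0 k0 _]|[/eqP]|[_ _]]; last 2 first.
    - by rewrite n1.
    - by move=> <-; rewrite opprK.
    by move/eqP: f0; rewrite oppr_eq0 k0 oppr0 => /eqP.
  by case: H => [[]|[/eqP]|[]] //; rewrite n1.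
(* For any other exponent, only the trivial alternative is left at each u. *)
have flat u : I u -> [/\ - f u = 0, conical_curvature e u = 0
    & cot_striction s e u = 0].
  move=> /pointwise[_ [//|[m0 _ _]|[m2 _ _]]].
    by move/eqP: m0; rewrite addr_eq0 (negPf n3).
  by case/eqP: n1; rewrite -(addrK 3 n) m2.
apply: Or31; split=> [u /flat[/eqP]|]; first by rewrite oppr_eq0 => /eqP.
by split=> // u /flat[].
Qed.
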